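(* Let $A\in\mathbb{H}^n_{++}$. For any $k\in\mathbb{N}$ with $1\le k\le n-1$ and any $\beta>1$, there exists a preconditioner $P\in\mathbb{H}^n_{++}$ such that $$\operatorname{tr}(P^{-1/2}AP^{-1/2}) = n, \qquad \beta = e^{\mathcal{D}_{\mathrm{LD}}(A,P)/n},$$ and a nonzero initial residual $r_0$ such that the $k$-th residual $r_k$ of the preconditioned conjugate gradient method applied to $Ax=b$ with preconditioner $P$ satisfies $$\|r_k\|_{P^{-1}} = (\beta^{n/k}-1)^{k/2}\,\|r_0\|_{P^{-1}} = \big(e^{\mathcal{D}_{\mathrm{LD}}(A,P)/k}-1\big)^{k/2}\,\|r_0\|_{P^{-1}}.$$
   Context: $\mathbb{H}^n_{++}$ denotes the set of $n\times n$ Hermitian positive definite matrices. For $A,P\in\mathbb{H}^n_{++}$ the Bregman log determinant divergence is $$\mathcal{D}_{\mathrm{LD}}(A,P) = \operatorname{tr}(AP^{-1}) - \ln\det(AP^{-1}) - n.$$ For $H\in\mathbb{H}^n_{++}$, $\|v\|_H=(v^*Hv)^{1/2}$. Preconditioned conjugate gradient method (PCG) for $Ax=b$ with preconditioner $P$, $H=P^{-1}$, and initial guess $x_0$: $r_0=b-Ax_0$, $p_0=Hr_0$, and for $k=0,1,2,\dots$ $$\alpha_k=\frac{r_k^*Hr_k}{p_k^*Ap_k},\quad x_{k+1}=x_k+\alpha_kp_k,\quad r_{k+1}=r_k-\alpha_kAp_k,\quad \beta_k=\frac{r_{k+1}^*Hr_{k+1}}{r_k^*Hr_k},\quad p_{k+1}=Hr_{k+1}+\beta_kp_k.$$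 If $r_k=0$ the iteration stops, and by convention $r_j=0$ and $x_j=x_k$ for all $j\ge k$. The residual sequence depends only on $A$, $P$ and $r_0$. *)

(* Defs.v *)
From mathcomp Require Import all_boot all_order all_algebra.
From mathcomp Require Export sesquilinear spectral.
From mathcomp Require Export complex.
From mathcomp Require Export reals sequences exp.

Set Implicit Arguments.
Unset Strict Implicit.
Unset Printing Implicit Defensive.

Import Order.TTheory GRing.Theory Num.Theory.
Local Open Scope ring_scope.
Local Open Scope sesquilinear_scope.
Local Open Scope complex_scope.

(* In R[i], 0 < z means that z is a positive real. *)
Definition hpdmx (R : realType) (n : nat) (A : 'M[R[i]]_n) : Prop :=
  A \is hermsymmx /\
  forall v : 'cV[R[i]]_n, v != 0 -> 0 < (v^t* *m A *m v) 0 0.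

(* Spectral calculus: P = U^-1 diag(d) U with U = spectralmx P unitary and
   d = spectral_diag P. The lemmas invsqrtmx_hpd and invsqrtmxK below show that
   invsqrtmx P is the positive definite square root of P^-1. *)
Definition invsqrtmx (R : realType) (n : nat) (P : 'M[R[i]]_n) : 'M[R[i]]_n :=
  invmx (spectralmx P)
    *m diag_mx (map_mx (fun z => (sqrtC z)^-1) (spectral_diag P))
    *m spectralmx P.

(* For A and P positive definite, trace and determinant of A P^-1 are real,
   so taking real parts loses nothing. *)
Definition logdet_div (R : realType) (n : nat) (A P : 'M[R[i]]_n) : R :=
  complex.Re (\tr (A *m invmx P)) - ln (complex.Re (\det (A *m invmx P)))
  - n%:R.

(* v^* H v is real when H is Hermitian. *)
Definition mxnorm (R : realType) (n : nat) (H : 'M[R[i]]_n)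
    (v : 'cV[R[i]]_n) : R :=
  Num.sqrt (complex.Re ((v^t* *m H *m v) 0 0)).

Record pcg_state (R : realType) (n : nat) := PcgState {
  pcg_x : 'cV[R[i]]_n;
  pcg_r : 'cV[R[i]]_n;
  pcg_p : 'cV[R[i]]_n }.

Definition pcg_init (R : realType) (n : nat) (A H : 'M[R[i]]_n)
    (b x0 : 'cV[R[i]]_n) : pcg_state R n :=
  let r0 := b - A *m x0 in PcgState x0 r0 (H *m r0).

(* A zero residual freezes the state: the iteration has stopped. *)
Definition pcg_step (R : realType) (n : nat) (A H : 'M[R[i]]_n)
    (s : pcg_state R n) : pcg_state R n :=
  let: PcgState x r p := s in
  if r == 0 then s else
  let alpha := (r^t* *m H *m r) 0 0 / (p^t* *m A *m p) 0 0 in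
  let r' := r - alpha *: (A *m p) in
  let beta := (r'^t* *m H *m r') 0 0 / (r^t* *m H *m r) 0 0 in
  PcgState (x + alpha *: p) r' (H *m r' + beta *: p).

Definition pcg (R : realType) (n : nat) (A P : 'M[R[i]]_n)
    (b x0 : 'cV[R[i]]_n) (k : nat) : pcg_state R n :=
  iter k (pcg_step A (invmx P)) (pcg_init A (invmx P) b x0).

Definition pcg_residual (R : realType) (n : nat) (A P : 'M[R[i]]_n)
    (b x0 : 'cV[R[i]]_n) (k : nat) : 'cV[R[i]]_n :=
  pcg_r (pcg A P b x0 k).

Lemma hpdmx_spectral (R : realType) (n : nat) (P : 'M[R[i]]_n) : hpdmx P ->
  P = (spectralmx P)^t* *m diag_mx (spectral_diag P) *m spectralmx P.
Proof.
move=> [Ph _]; have Pn : P \is normalmx by exact: hermitian_normalmx.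
rewrite [LHS](orthomx_spectralP Pn) invmx_unitary //.
exact: spectral_unitarymx.
Qed.

Lemma hpdmx_spectral_diag_gt0 (R : realType) (n : nat) (P : 'M[R[i]]_n) i :
  hpdmx P -> 0 < spectral_diag P 0 i.
Proof.
move=> hP; have Uu := spectral_unitarymx P.
have /unitarymxP UU := Uu.
pose U := spectralmx P; pose e : 'cV[R[i]]_n := delta_mx i 0.
have [v Uv] : exists v, U *m v = e.
  by exists (U^t* *m e); rewrite mulmxA UU mul1mx.
have v0 : v != 0.
  apply/eqP => v0; move: Uv; rewrite v0 mulmx0 => /matrixP/(_ i 0).
  by rewrite !mxE !eqxx => /esym/eqP; rewrite oner_eq0.
have := hP.2 v v0; rewrite {1}(hpdmx_spectral hP) -/U !mulmxA.
have -> : v^t* *m U^t* = e^t* by rewrite -map_mxM -trmx_mul Uv.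
rewrite -[_ *m U *m v]mulmxA Uv -mulmxA mul_diag_mx mxE (bigD1 i) //= big1.
  by rewrite addr0 !mxE !eqxx conjC1 mul1r mulr1.
by move=> j ji; rewrite !mxE (negbTE ji) conjC0 mul0r.
Qed.

Lemma invsqrtmx_hpd (R : realType) (n : nat) (P : 'M[R[i]]_n) :
  hpdmx P -> hpdmx (invsqrtmx P).
Proof.
move=> hP; have Uu := spectral_unitarymx P.
have d0 i : 0 < (sqrtC (spectral_diag P 0 i))^-1.
  by rewrite invr_gt0 sqrtC_gt0 hpdmx_spectral_diag_gt0.
rewrite /invsqrtmx invmx_unitary //; set U := spectralmx P; set D := diag_mx _.
split.
  apply/is_hermitianmxP; rewrite expr0 scale1r !trmx_mul !map_mxM mulmxA.
  rewrite trmxCK.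
  congr (_ *m _ *m _); apply/matrixP => i j; rewrite !mxE eq_sym.
  case: eqP => [->|_]; last by rewrite !mulr0n rmorph0.
  by rewrite !mulr1n; apply/esym/geC0_conj/ltW.
move=> v v0; have [w wE] : exists w, w = U *m v by exists (U *m v).
have w0 : w != 0.
  apply: contra v0 => /eqP/(congr1 (mulmx (invmx U))).
  by rewrite mulmx0 wE mulKmx ?unitarymx_unit // => ->.
rewrite !mulmxA -[v^t* *m _]map_mxM -trmx_mul -wE -[_ *m U *m v]mulmxA -wE.
rewrite -mulmxA mul_diag_mx mxE.
have [i wi] : exists i, w i 0 != 0.
  apply/existsP; apply: contraR w0; rewrite negb_exists => /forallP h.
  by apply/eqP/matrixP => i j; rewrite ord1 mxE; apply/eqP/negbNE/h.
have E j : (w^t*) 0 j *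
    (\matrix_(i0, j0) (map_mx (fun z => (sqrtC z)^-1) (spectral_diag P) 0 i0
      * w i0 j0)) j 0
    = (sqrtC (spectral_diag P 0 j))^-1 * `|w j 0| ^+ 2.
  by rewrite !mxE normCK mulrCA [_^* * _]mulrC.
rewrite (bigD1 i) //= ltr_wpDr //.
  apply: sumr_ge0 => j _; rewrite E.
  by apply: mulr_ge0; [exact: ltW | exact: exprn_ge0].
by rewrite E; apply: mulr_gt0 => //; rewrite exprn_gt0 // normr_gt0.
Qed.

Lemma invsqrtmxK (R : realType) (n : nat) (P : 'M[R[i]]_n) :
  hpdmx P -> invsqrtmx P *m invsqrtmx P = invmx P.
Proof.
move=> hP; have Uu := spectral_unitarymx P.
have Un := unitarymx_unit Uu.
have PE := hpdmx_spectral hP; rewrite -invmx_unitary // in PE.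
have SP : invsqrtmx P *m invsqrtmx P *m P = 1%:M.
  rewrite {3}PE /invsqrtmx !mulmxA !(mulmxK Un, mulmxKV Un).
  rewrite -[_ *m diag_mx _ *m diag_mx _]mulmxA mulmx_diag.
  rewrite -[_ *m diag_mx _ *m diag_mx _]mulmxA mulmx_diag.
  set d := diag_mx _; suff -> : d = 1%:M by rewrite mulmx1 mulVmx.
  apply/matrixP => i j; rewrite !mxE; congr (_ *+ _).
  have p0 := hpdmx_spectral_diag_gt0 i hP.
  by rewrite mulrA -invfM -expr2 sqrtCK mulVf // gt_eqF.
have [_ Pu] := mulmx1_unit SP.
by rewrite -[LHS](mulmxK Pu) SP mul1mx.
Qed.

(* Main.v *)
Require Import Defs.
From mathcomp Require Import all_boot all_order all_algebra.
From mathcomp Require Import sesquilinear spectral complex reals sequences exp.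
From mathcomp Require Import ring zify.

(** Write S = A^(-1/2), and look for the preconditioner through a factor of its
inverse: P^-1 = W^* W with W = K S.  Then tr(A P^-1) and det(A P^-1) are the
trace and determinant of K K^*, and the residuals of the method, read in the
coordinates W r, are those of plain conjugate gradients on K K^*; in
particular |r|_(P^-1) is the Euclidean norm of W r.  Everything thus depends
on the choice of K.

Put g = beta^(n/k) > 1, c = g^(-1/2) and s = (g - 1)^(1/2), so that
c^2 (1 + s^2) = 1.  Take for K the lower bidiagonal matrix with columns
K e_j = c (e_j - s e_(j+1)) for j < k, and K e_j = e_j for the others.

- All columns of K are unit vectors, so tr(K K^* ) = n (bidiag_trace).
- det K = c^k (bidiag_det), so det(K K^* ) = g^(-k) = beta^(-n), which is the
  condition on the divergence once the trace is n.
- K K^* is a tridiagonal matrix factored as in the Lanczos process with all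
  the conjugate gradient coefficients beta_j equal to s^2.  Starting from
  W r_0 = e_0, the method therefore produces W r_j = s^j e_j for j <= k, with
  search directions c s^j S e_j, which are A-orthogonal because
  S A S = 1 (pcg_bidiag_state).

Hence |r_k| = s^k |r_0| = (g - 1)^(k/2) |r_0| in the norm of P^-1.  The column
k - 1 of K reaches into row k, and this is where k <= n - 1 is used. *)

Import Order.TTheory GRing.Theory Num.Theory.
Local Open Scope ring_scope.
Local Open Scope sesquilinear_scope.

(** * Bidiagonal matrices with unit columns *)

(** The index is a natural number, so that e_(j+1) needs no proof that j + 1 is
in range; out of range the vector is zero. *)
Definition unit_col (C : numClosedFieldType) (n j : nat) : 'cV[C]_n :=
  \col_i (i == j :> nat)%:R.
Arguments unit_col {C n} j.

(** The columns from k on are those of the identity, so that the trailing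
coordinates stay out of the iteration and do not change the determinant. *)
Definition bidiag (C : numClosedFieldType) (n k : nat) (c s : C) : 'M[C]_n :=
  \matrix_(i, j) (if (j < k)%N then
    c * ((i == j :> nat)%:R - s * (i == j.+1 :> nat)%:R)
    else (i == j :> nat)%:R).
Arguments bidiag {C n} k c s.

Lemma trmxC_mul (C : numClosedFieldType) (m n p : nat)
    (A : 'M[C]_(m, n)) (B : 'M[C]_(n, p)) :
  (A *m B) ^t* = B ^t* *m A ^t*.
Proof. by rewrite trmx_mul map_mxM. Qed.

Lemma trmxC_scale (C : numClosedFieldType) (m n : nat) (a : C)
    (A : 'M[C]_(m, n)) : (a *: A) ^t* = a^* *: A ^t*.
Proof. by apply/matrixP => i j; rewrite !mxE rmorphM. Qed.

Lemma unit_col_dot (C : numClosedFieldType) (n i j : nat) : (i < n)%N ->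
  ((unit_col i : 'cV[C]_n)^t* *m unit_col j) 0 0 = (i == j)%:R.
Proof.
move=> ltin; rewrite mxE (bigD1 (Ordinal ltin)) //= big1 => [|l ne].
  by rewrite !mxE eqxx conjC1 mul1r addr0.
rewrite !mxE; case: eqP => [e|]; last by rewrite conjC0 mul0r.
by case/eqP: ne; apply: val_inj.
Qed.

Lemma mul_unit_col (C : numClosedFieldType) (m n : nat) (B : 'M[C]_(m, n))
    (j : 'I_n) : B *m unit_col j = col j B.
Proof.
apply/matrixP => i l; rewrite !mxE (bigD1 j) //= big1 => [|h ne].
  by rewrite mxE eqxx mulr1 addr0.
by rewrite mxE (negbTE (ne : (h != j :> nat))) mulr0.
Qed.

Lemma bidiag_unit_col (C : numClosedFieldType) (n k j : nat) (c s : C) :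
  (k < n)%N -> (j < k)%N ->
  bidiag k c s *m (unit_col j : 'cV_n)
    = c *: (unit_col j - s *: unit_col j.+1).
Proof.
move=> ltkn ltjk; have ltjn := ltn_trans ltjk ltkn.
rewrite -[j in LHS]/(val (Ordinal ltjn)) mul_unit_col.
by apply/matrixP => i l; rewrite !mxE /= ltjk.
Qed.

(** For j > 0 the image has a component along e_(j-1): the conjugate gradient
recurrence for the directions adds the multiple of the previous direction that
cancels it. *)
Lemma bidiag_adj_unit_col (C : numClosedFieldType) (n k j : nat) (c s : C) :
  0 < c -> 0 < s -> (k < n)%N -> (j < k)%N ->
  (bidiag k c s)^t* *m (unit_col j : 'cV_n)
    = c *: (unit_col j - (if j is i.+1 then s *: unit_col i else 0)).
Proof.
move=> c0 s0 ltkn ltjk; have ltjn := ltn_trans ltjk ltkn.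
have cc : c^* = c by apply/geC0_conj/ltW.
have ss : s^* = s by apply/geC0_conj/ltW.
rewrite -[j in LHS]/(val (Ordinal ltjn)) mul_unit_col.
apply/matrixP => i l; rewrite !mxE /=.
have -> : (if j is i0.+1 then s *: unit_col i0 else 0 : 'cV[C]_n) i l
          = s * (j == i.+1 :> nat)%:R.
  by case: (j) => [|h]; rewrite !mxE ?mulr0 // eqSS eq_sym.
rewrite [(j == i :> nat)]eq_sym; case: ifP => [_|/negbT].
  by rewrite rmorphM rmorphB rmorphM /= !rmorph_nat cc ss.
rewrite -leqNgt => leki; have ltji := leq_trans ltjk leki.
rewrite (gtn_eqF ltji) (ltn_eqF (ltn_trans ltji (ltnSn i))) rmorph_nat.
by rewrite mulr0n; ring.
Qed.

(** The trace of K K^* is that of K^* K, whose diagonal holds the squared norms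
of the columns of K: c^2 (1 + s^2) = 1 for the first k, and 1 for the rest. *)
Lemma bidiag_trace (C : numClosedFieldType) (n k : nat) (c s : C) :
  0 < c -> 0 < s -> (k < n)%N -> c ^+ 2 * (1 + s ^+ 2) = 1 ->
  \tr ((bidiag k c s : 'M_n) *m (bidiag k c s)^t*) = n%:R.
Proof.
move=> c0 s0 ltkn norm1; rewrite mxtrace_mulC.
have cc : c^* = c by apply/geC0_conj/ltW.
have ss : s^* = s by apply/geC0_conj/ltW.
set K := bidiag k c s.
rewrite /mxtrace (eq_bigr (fun=> 1)) => [|j _].
  by rewrite big_const_ord iter_addr_0.
have -> : (K^t* *m K) j j = ((K *m unit_col j)^t* *m (K *m unit_col j)) 0 0.
  by rewrite mul_unit_col !mxE; apply: eq_bigr => i _; rewrite !mxE.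
have ltjn := ltn_ord j.
case: (ltnP j k) => [ltjk|lekj]; last first.
  suff -> : K *m unit_col j = unit_col j by rewrite unit_col_dot // eqxx.
  by rewrite mul_unit_col; apply/matrixP => i l; rewrite !mxE ltnNge lekj.
have ltj1n : (j.+1 < n)%N by apply: leq_ltn_trans ltkn.
rewrite bidiag_unit_col //.
set u := unit_col j; set v := unit_col j.+1.
have -> : (c *: (u - s *: v))^t* = c *: (u^t* - s *: v^t*).
  by apply/matrixP => a b; rewrite !mxE !(rmorphM, rmorphB) /= cc ss.
have -> : (c *: (u^t* - s *: v^t*)) *m (c *: (u - s *: v)) =
    c ^+ 2 *: (u^t* *m u - s *: (u^t* *m v + v^t* *m u)
               + s ^+ 2 *: (v^t* *m v)).
  rewrite -scalemxAl -scalemxAr scalerA -expr2 mulmxBl !mulmxBr.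
  rewrite -!scalemxAl -!scalemxAr; congr (_ *: _).
  by apply/matrixP => a b; rewrite !mxE; ring.
have := (unit_col_dot C n j j ltjn, unit_col_dot C n j j.+1 ltjn).
have := (unit_col_dot C n j.+1 j ltj1n, unit_col_dot C n j.+1 j.+1 ltj1n).
rewrite -/u -/v !eqxx (ltn_eqF (ltnSn j)) (gtn_eqF (ltnSn j)).
move: (u^t* *m u) (u^t* *m v) (v^t* *m u) (v^t* *m v).
move=> uu uv vu vv [vuE vvE] [uuE uvE].
by rewrite !mxE uuE uvE vuE vvE -[RHS]norm1 /=; ring.
Qed.

Lemma bidiag_det (C : numClosedFieldType) (n k : nat) (c s : C) :
  (k < n)%N -> \det (bidiag k c s : 'M_n) = c ^+ k.
Proof.
move=> ltkn; rewrite det_trig; last first.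
  apply/is_trig_mxP => i j ltij; rewrite mxE (ltn_eqF ltij).
  by rewrite (ltn_eqF (ltn_trans ltij (ltnSn j))) !mulr0 subrr mulr0 if_same.
rewrite (eq_bigr (fun i : 'I_n => if (i < k)%N then c else 1)) => [|i _].
  rewrite -big_mkcond -(big_ord_widen n (fun=> c) (ltnW ltkn)) /=.
  by rewrite prodr_const card_ord.
by rewrite mxE eqxx (ltn_eqF (ltnSn i)) mulr0 subr0 mulr1.
Qed.

Local Open Scope complex_scope.

(** * Positive definite matrices *)

Lemma hpdmx_gram (R : realType) (n : nat) (V : 'M[R[i]]_n) :
  V \in unitmx -> hpdmx (V *m V^t*).
Proof.
move=> Vu; split.
  by apply/is_hermitianmxP; rewrite expr0 scale1r trmxC_mul trmxCK.
move=> v v0; set w := V^t* *m v.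
have w0 : w != 0.
  apply: contra v0 => /eqP wE.
  have Vu' : V^t* \in unitmx by rewrite map_unitmx unitmx_tr.
  by rewrite -(mulKmx Vu' v) -/w wE mulmx0.
have -> : v^t* *m (V *m V^t*) *m v = w^t* *m w.
  by rewrite trmxC_mul trmxCK !mulmxA.
have [i wi] : exists i, w i 0 != 0.
  apply/existsP; apply: contraR w0; rewrite negb_exists => /forallP h.
  by apply/eqP/matrixP => i j; have := h i; rewrite negbK ord1 [RHS]mxE => /eqP.
have E j : (w^t*) 0 j * w j 0 = `|w j 0| ^+ 2.
  by rewrite !mxE normCK mulrC.
rewrite mxE (bigD1 i) //= ltr_wpDr //.
  by apply: sumr_ge0 => j _; rewrite E exprn_ge0.
by rewrite E exprn_gt0 // normr_gt0.
Qed.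

Lemma invsqrtmx_adj (R : realType) (n : nat) (A : 'M[R[i]]_n) :
  hpdmx A -> (invsqrtmx A)^t* = invsqrtmx A.
Proof.
move=> hA; have [/is_hermitianmxP] := invsqrtmx_hpd hA.
by rewrite expr0 scale1r.
Qed.

Lemma hpdmx_unit (R : realType) (n : nat) (A : 'M[R[i]]_n) :
  hpdmx A -> A \in unitmx.
Proof.
move=> hA; rewrite unitmxE (hpdmx_spectral hA) !det_mulmx det_diag.
have Uu := unitarymx_unit (spectral_unitarymx A).
rewrite !unitrM -!unitmxE map_unitmx unitmx_tr Uu andbT /= unitfE.
by apply/prodf_neq0 => i _; rewrite gt_eqF // hpdmx_spectral_diag_gt0.
Qed.

(** From S S = A^-1 one gets S (S A) = 1, and the one-sided inverse S of S A is
two-sided. *)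
Lemma invsqrtmx_whiten (R : realType) (n : nat) (A : 'M[R[i]]_n) :
  hpdmx A -> invsqrtmx A *m A *m invsqrtmx A = 1%:M.
Proof.
move=> hA; rewrite -mulmxA; apply: mulmx1C.
by rewrite -mulmxA invsqrtmxK // mulmxV // hpdmx_unit.
Qed.

(** * Conjugate gradients along a bidiagonal factor *)

(** Closed form of the iterates, for K the bidiagonal matrix, W = K S and
H = P^-1 = W^* W.  A step maps W r = s^j e_j and
p = c s^j S e_j to the same form at j + 1: one has r^* H r = s^(2j),
p^* A p = c^2 s^(2j) and W A p = c s^j K e_j, so the step length is c^-2 and
W r' = s^j e_j - s^j (e_j - s e_(j+1)).  The direction follows from
H r' = S K^* W r' and the coefficient s^2, since the e_j components of
K^* (s^(j+1) e_(j+1)) and of s^2 c s^j e_j cancel.  At j = k only the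
residual has this form, because the column k of K is not part of the chain. *)
Lemma pcg_bidiag_state (R : realType) (n : nat) (A P S : 'M[R[i]]_n)
    (k j : nat) (c s : R[i]) (b x0 : 'cV[R[i]]_n) :
  0 < c -> 0 < s -> (k < n)%N ->
  S^t* = S -> S *m A *m S = 1%:M ->
  invmx P = (bidiag k c s *m S)^t* *m (bidiag k c s *m S) ->
  bidiag k c s *m S *m (b - A *m x0) = unit_col 0 ->
  (j <= k)%N ->
  bidiag k c s *m S *m pcg_r (pcg A P b x0 j) = s ^+ j *: unit_col j /\
  ((j < k)%N -> pcg_p (pcg A P b x0 j) = (c * s ^+ j) *: (S *m unit_col j)).
Proof.
move=> c0 s0 ltkn adjS SAS PE r0E.
have cn0 : c != 0 by rewrite gt_eqF.
have sn0 : s != 0 by rewrite gt_eqF.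
set K := bidiag k c s in PE r0E *.
have PE' : invmx P = S *m K^t* *m (K *m S) by rewrite PE trmxC_mul adjS.
have HE r h : (h < k)%N -> K *m S *m r = s ^+ h *: unit_col h ->
    invmx P *m r = (s ^+ h * c) *:
      (S *m (unit_col h - (if h is i.+1 then s *: unit_col i else 0))).
  move=> lthk rE; rewrite PE' -[_ *m _ *m r]mulmxA rE -scalemxAr -mulmxA.
  by rewrite bidiag_adj_unit_col // -scalemxAr scalerA.
have normE r h : (h < n)%N -> K *m S *m r = s ^+ h *: unit_col h ->
    (r^t* *m invmx P *m r) 0 0 = (s ^+ h) ^+ 2.
  move=> lthn rE; rewrite PE [r^t* *m _]mulmxA -trmxC_mul -[_ *m _ *m r]mulmxA.
  rewrite rE trmxC_scale (geC0_conj (exprn_ge0 _ (ltW s0))).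
  by rewrite -scalemxAl -scalemxAr scalerA mxE unit_col_dot // eqxx
    mulr1 -expr2.
elim: j => [|j IH] lejk.
  split; first by rewrite /pcg /pcg_residual /= r0E expr0 scale1r.
  move=> k0 /=; rewrite (HE _ 0%N) //; last by rewrite r0E expr0 scale1r.
  by rewrite subr0 mulrC.
have [rE /(_ lejk) pE] := IH (ltnW lejk).
have ltjn := leq_trans lejk (ltnW ltkn).
rewrite /pcg iterS -/(pcg A P b x0 j).
case: (pcg A P b x0 j) rE pE => x r p /= rE pE.
have r_neq0 : r != 0.
  apply/eqP => r0; move: rE; rewrite r0 mulmx0 => /esym/matrixP.
  move=> /(_ (Ordinal ltjn) 0); rewrite !mxE eqxx mulr1 => /eqP.
  by rewrite expf_eq0 (negbTE sn0) andbF.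
rewrite (negbTE r_neq0) /=.
have xn0 : s ^+ j != 0 by rewrite expf_neq0.
have rHr := normE _ _ ltjn rE.
have pAp : (p^t* *m A *m p) 0 0 = (c * s ^+ j) ^+ 2.
  have -> : p^t* *m A *m p = (c * s ^+ j) ^+ 2 *:
      ((unit_col j : 'cV_n)^t* *m unit_col j).
    rewrite pE trmxC_scale trmxC_mul adjS.
    rewrite (geC0_conj (mulr_ge0 (ltW c0) (exprn_ge0 _ (ltW s0)))).
    rewrite -!scalemxAl -scalemxAr scalerA -expr2 -2!mulmxA.
    by congr (_ *: (_ *m _)); rewrite !mulmxA SAS mul1mx.
  by rewrite mxE unit_col_dot // eqxx mulr1.
rewrite rHr pAp.
set r' := r - _.
have r'E : K *m S *m r' = s ^+ j.+1 *: unit_col j.+1.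
  rewrite /r' mulmxBr rE pE -!scalemxAr scalerA.
  have -> : K *m S *m (A *m (S *m unit_col j))
            = K *m (S *m A *m S) *m unit_col j by rewrite !mulmxA.
  rewrite SAS mulmx1 bidiag_unit_col // [s ^+ j.+1]exprS.
  by apply/matrixP => a l; rewrite !mxE; field; rewrite xn0 cn0.
split=> // ltj1k.
rewrite (HE _ _ ltj1k r'E) (normE _ _ _ r'E); last exact: ltn_trans ltkn.
rewrite pE /= mulmxBr -!scalemxAr [s ^+ j.+1]exprS.
by apply/matrixP => a l; rewrite !mxE; field; rewrite xn0.
Qed.

Lemma mxnorm_gram_unit_col (R : realType) (n : nat) (W : 'M[R[i]]_n)
    (v : 'cV[R[i]]_n) (a : R) (j : nat) :
  0 <= a -> (j < n)%N -> W *m v = a%:C *: unit_col j ->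
  mxnorm (W^t* *m W) v = a.
Proof.
move=> a0 ltjn vE; rewrite /mxnorm.
rewrite [v^t* *m _]mulmxA -trmxC_mul -[_ *m _ *m v]mulmxA vE trmxC_scale.
rewrite geC0_conj ?(lecR 0) // -scalemxAl -scalemxAr scalerA mxE.
by rewrite unit_col_dot // eqxx mulr1 -rmorphM /= -expr2 sqrtr_sqr ger0_norm.
Qed.

Theorem corollary2 (R : realType) (n : nat) (A : 'M[R[i]]_n) (hA : hpdmx A)
    (k : nat) (hk : (1 <= k <= n - 1)%N) (beta : R) (hbeta : 1 < beta) :
  exists P : 'M[R[i]]_n,
    [/\ hpdmx P,
        \tr (invsqrtmx P *m A *m invsqrtmx P) = n%:R,
        beta = expR (logdet_div A P / n%:R) &
        exists r0 : 'cV[R[i]]_n,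
          r0 != 0 /\
          forall b x0 : 'cV[R[i]]_n, b - A *m x0 = r0 ->
            mxnorm (invmx P) (pcg_residual A P b x0 k)
              = (beta `^ (n%:R / k%:R) - 1) `^ (k%:R / 2)
                * mxnorm (invmx P) r0 /\
            (beta `^ (n%:R / k%:R) - 1) `^ (k%:R / 2) * mxnorm (invmx P) r0
              = (expR (logdet_div A P / k%:R) - 1) `^ (k%:R / 2)
                * mxnorm (invmx P) r0].
Proof.
have /andP[k0 lekn] := hk.
have ltkn : (k < n)%N by lia.
have n0 : (0 < n)%N by lia.
have beta0 : 0 < beta by apply: lt_trans hbeta.
have kR0 : k%:R != 0 :> R by rewrite pnatr_eq0 -lt0n.
have nR0 : n%:R != 0 :> R by rewrite pnatr_eq0 -lt0n.
set g := beta `^ (n%:R / k%:R).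
have gE : g = expR (n%:R / k%:R * ln beta) by rewrite /g /powR gt_eqF.
have g1 : 1 < g.
  by rewrite gE expR_gt1 mulr_gt0 ?ln_gt0 // divr_gt0 // ltr0n.
have g0 : 0 < g by apply: lt_trans g1.
pose s := Num.sqrt (g - 1); pose c := Num.sqrt g^-1.
have s0 : 0 < s by rewrite sqrtr_gt0 subr_gt0.
have c0 : 0 < c by rewrite sqrtr_gt0 invr_gt0.
have c2 : c ^+ 2 = g^-1 by rewrite sqr_sqrtr // invr_ge0 ltW.
have s2 : s ^+ 2 = g - 1 by rewrite sqr_sqrtr // subr_ge0 ltW.
have c0C : 0 < c%:C by rewrite (ltcR 0).
have s0C : 0 < s%:C by rewrite (ltcR 0).
have norm1 : c%:C ^+ 2 * (1 + s%:C ^+ 2) = 1.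
  have <- : (c ^+ 2 * (1 + s ^+ 2))%:C = c%:C ^+ 2 * (1 + s%:C ^+ 2).
    by rewrite rmorphM rmorphD !rmorphXn rmorph1.
  by rewrite c2 s2 subrKC mulVf // gt_eqF.
pose S := invsqrtmx A.
pose K : 'M[R[i]]_n := bidiag k c%:C s%:C.
have adjS : S^t* = S by exact: invsqrtmx_adj.
have SAS : S *m A *m S = 1%:M by exact: invsqrtmx_whiten.
pose W := K *m S.
have detK : \det K = c%:C ^+ k by exact: bidiag_det.
have Wu : W \in unitmx.
  rewrite unitmx_mul [S \in _]hpdmx_unit ?andbT; last exact: invsqrtmx_hpd.
  by rewrite unitmxE detK unitfE expf_neq0 // gt_eqF.
have adjWV : (invmx W)^t* = invmx (W^t*).
  by rewrite trmx_inv map_invmx.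
pose P := invmx W *m (invmx W)^t*.
have hP : hpdmx P by apply: hpdmx_gram; rewrite unitmx_inv.
have PE : invmx P = W^t* *m W.
  have PW : P *m (W^t* *m W) = 1%:M.
    rewrite /P adjWV mulmxA mulmxKV ?mulVmx //.
    by rewrite map_unitmx unitmx_tr.
  by rewrite -[RHS](mulKmx (hpdmx_unit _ _ _ hP)) PW mulmx1.
have WAW : W *m A *m W^t* = K *m K^t*.
  rewrite trmxC_mul adjS.
  have -> : W *m A *m (S *m K^t*) = K *m (S *m A *m S) *m K^t*.
    by rewrite !mulmxA.
  by rewrite SAS mulmx1.
have div : logdet_div A P = n%:R * ln beta.
  rewrite /logdet_div.
  have -> : \tr (A *m invmx P) = n%:R.
    by rewrite PE mulmxA mxtrace_mulC mulmxA WAW bidiag_trace.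
  have -> : \det (A *m invmx P) = (g ^- k)%:C.
    rewrite PE mulmxA det_mulmx mulrC -det_mulmx mulmxA WAW det_mulmx.
    have -> : \det (K^t*) = c%:C ^+ k.
      by rewrite det_map_mx det_tr detK; apply/geC0_conj/exprn_ge0/ltW.
    rewrite detK.
    by rewrite -exprMn -expr2 -!rmorphXn /= c2 exprVn.
  have -> : complex.Re (n%:R : R[i]) = n%:R.
    by rewrite -(rmorph_nat (real_complex R)).
  rewrite /= addrAC subrr add0r lnV ?posrE ?exprn_gt0 // lnXn // opprK gE expRK.
  by rewrite -mulr_natl; field.
exists P; split=> //.
- rewrite mxtrace_mulC mulmxA invsqrtmxK // PE mxtrace_mulC mulmxA.
  by rewrite mxtrace_mulC mulmxA WAW bidiag_trace.
- by rewrite div mulrAC divff // mul1r lnK.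
pose r0 := invmx W *m unit_col 0.
have r0E : W *m r0 = 1%:C *: unit_col 0 by rewrite mulKVmx // scale1r.
have normr0 : mxnorm (invmx P) r0 = 1.
  by rewrite PE (mxnorm_gram_unit_col _ _ _ _ _ 0%N _ _ r0E).
exists r0; split.
  apply: contra_eq_neq normr0 => ->.
  by rewrite /mxnorm mulmx0 mxE sqrtr0 eq_sym oner_eq0.
move=> b x0 r0_def.
have -> : expR (logdet_div A P / k%:R) = g by rewrite div gE mulrAC.
split=> //.
rewrite normr0 mulr1 PE (mxnorm_gram_unit_col _ _ _ _ (s ^+ k) k) //.
- rewrite [_ / 2]mulrC powRrM powR12_sqrt ?powR_mulrn ?sqrtr_ge0 //.
  by rewrite subr_ge0 ltW.
- exact/exprn_ge0/ltW.
rewrite rmorphXn.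
have Wr0 : W *m (b - A *m x0) = unit_col 0 by rewrite r0_def r0E scale1r.
by have [] := pcg_bidiag_state R n A P S k k c%:C s%:C b x0
  c0C s0C ltkn adjS SAS PE Wr0 (leqnn k).
Qed.
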